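(* Let $p\ge 2$ be a prime and let $1\le m\le k$ be integers. If $f:\mathbb{Z}_p\to\mathbb{Z}_p$ is a $(p^{-k},p^{m})$ locally scaling map, then $f$ is Lipschitz structurally stable.
   Context: $\mathbb{Z}_p$ is the ring of $p$-adic integers with the $p$-adic norm $\|\cdot\|_p$ (normalized so that $\|p\|_p=p^{-1}$) and metric $d(x,y)=\|x-y\|_p$. A map $f:\mathbb{Z}_p\to\mathbb{Z}_p$ is $(p^{-k},p^m)$ locally scaling if for all $x,y\in\mathbb{Z}_p$ with $\|x-y\|_p\le p^{-k}$ one has $\|f(x)-f(y)\|_p=p^m\|x-y\|_p$. Two maps $f,g:X\to X$ of a metric space are topologically conjugate if there is a homeomorphism $h:X\to X$ with $f\circ h=h\circ g$. A continuous map $f:\mathbb{Z}_p\to\mathbb{Z}_p$ is Lipschitz structurally stable if there exists $\varepsilon>0$ such that for every map $\psi:\mathbb{Z}_p\to\mathbb{Z}_p$ that is Lipschitz with constant at most $\varepsilon$ and satisfies $\|\psi\|_\infty:=\sup_x\|\psi(x)\|_p<\varepsilon$, the map $g=f+\psi$ is topologically conjugate to $f$. *)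

(* Defs.v *)
From HB Require Import structures.
From mathcomp Require Import all_boot all_order all_algebra.
From mathcomp Require Import all_classical all_reals.
From mathcomp Require Import topology.

Set Implicit Arguments.
Unset Strict Implicit.
Unset Printing Implicit Defensive.
Import Order.TTheory GRing.Theory Num.Theory.
Local Open Scope classical_set_scope.
Local Open Scope ring_scope.

(* The p-adic integers are the inverse limit of the rings Z/p^n: the n-th
   component of x is its residue modulo p^n, represented in [0, p^n).
   The construction makes sense for every p : nat (p = 0 gives Z, p = 1 the
   zero ring), so no primality proof is carried by the type. *)
Definition padic_coherent (p : nat) (u : nat -> int) :=
  forall n, u n = (u n.+1 %% (p ^ n)%N%:Z)%Z.

Structure padic_int (p : nat) := PadicInt {
  residue :> nat -> int;
  _ : `[< padic_coherent p residue >]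
}.

HB.instance Definition _ p := [isSub for @residue p].
HB.instance Definition _ p := [Choice of padic_int p by <:].

Section PadicRing.
Variable p : nat.
Implicit Types (x y z : padic_int p) (n : nat).

Lemma residueS x n : x n = (x n.+1 %% (p ^ n)%N%:Z)%Z.
Proof. by case: x => u /= /asboolP. Qed.

Lemma residue_mod x n : (x n %% (p ^ n)%N%:Z)%Z = x n.
Proof. by rewrite residueS modz_mod. Qed.

Lemma padic_eqP x y : (forall n, x n = y n) -> x = y.
Proof. by move=> xy; apply: val_inj; apply: funext. Qed.

Lemma modz_pS (a : int) n :
  ((a %% (p ^ n.+1)%N%:Z)%Z %% (p ^ n)%N%:Z)%Z = (a %% (p ^ n)%N%:Z)%Z.
Proof.
by rewrite {2}(divz_eq a (p ^ n.+1)%N%:Z) expnS PoszM mulrA modzMDl.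
Qed.

Fact of_int_subproof (a : int) :
  `[< padic_coherent p (fun n => (a %% (p ^ n)%N%:Z)%Z) >].
Proof. by apply/asboolP => n; rewrite modz_pS. Qed.
Definition padic_of_int a := PadicInt (of_int_subproof a).

Fact add_subproof x y :
  `[< padic_coherent p (fun n => ((x n + y n) %% (p ^ n)%N%:Z)%Z) >].
Proof.
by apply/asboolP => n; rewrite modz_pS [x n]residueS [y n]residueS modzDm.
Qed.
Definition padic_add x y := PadicInt (add_subproof x y).

Fact opp_subproof x :
  `[< padic_coherent p (fun n => ((- x n) %% (p ^ n)%N%:Z)%Z) >].
Proof. by apply/asboolP => n; rewrite modz_pS [x n]residueS modzNm. Qed.
Definition padic_opp x := PadicInt (opp_subproof x).

Fact mul_subproof x y :
  `[< padic_coherent p (fun n => ((x n * y n) %% (p ^ n)%N%:Z)%Z) >].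
Proof.
by apply/asboolP => n; rewrite modz_pS [x n]residueS [y n]residueS modzMm.
Qed.
Definition padic_mul x y := PadicInt (mul_subproof x y).

Fact padic_addA : associative padic_add.
Proof.
by move=> x y z; apply: padic_eqP => n /=; rewrite modzDmr modzDml addrA.
Qed.

Fact padic_addC : commutative padic_add.
Proof. by move=> x y; apply: padic_eqP => n /=; rewrite addrC. Qed.

Fact padic_add0 : left_id (padic_of_int 0) padic_add.
Proof.
by move=> x; apply: padic_eqP => n /=; rewrite modzDml add0r residue_mod.
Qed.

Fact padic_addN : left_inverse (padic_of_int 0) padic_opp padic_add.
Proof. by move=> x; apply: padic_eqP => n /=; rewrite modzDml addNr. Qed.

HB.instance Definition _ := GRing.isZmodule.Build (padic_int p)
  padic_addA padic_addC padic_add0 padic_addN.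

Fact padic_mulA : associative padic_mul.
Proof.
by move=> x y z; apply: padic_eqP => n /=; rewrite modzMmr modzMml mulrA.
Qed.

Fact padic_mulC : commutative padic_mul.
Proof. by move=> x y; apply: padic_eqP => n /=; rewrite mulrC. Qed.

Fact padic_mul1 : left_id (padic_of_int 1) padic_mul.
Proof.
by move=> x; apply: padic_eqP => n /=; rewrite modzMml mul1r residue_mod.
Qed.

Fact padic_mulDl : left_distributive padic_mul (@GRing.add (padic_int p)).
Proof.
by move=> x y z; apply: padic_eqP => n /=; rewrite modzMml modzDm mulrDl.
Qed.

HB.instance Definition _ := GRing.Zmodule_isComPzRing.Build (padic_int p)
  padic_mulA padic_mulC padic_mul1 padic_mulDl.

Lemma residue0 n : (0 : padic_int p) n = 0.
Proof. exact: mod0z. Qed.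

Lemma residueD x y n : (x + y) n = ((x n + y n) %% (p ^ n)%N%:Z)%Z.
Proof. by []. Qed.

Lemma residueN x n : (- x) n = ((- x n) %% (p ^ n)%N%:Z)%Z.
Proof. by []. Qed.

Lemma residueM x y n : (x * y) n = ((x n * y n) %% (p ^ n)%N%:Z)%Z.
Proof. by []. Qed.

Lemma residueB_eq0 x y n : (x - y) n = 0 <-> x n = y n.
Proof.
rewrite residueD residueN modzDmr; split=> [/eqP|->]; last by rewrite subrr mod0z.
by rewrite -[_ == 0]/(_ == 0%Z) -[0%Z](mod0z (p ^ n)%N%:Z) => xy0;
   rewrite -(residue_mod x) -(residue_mod y); apply/eqP;
   rewrite eqz_mod_dvd; apply/dvdz_mod0P/eqP; rewrite -[X in _ == X](mod0z (p ^ n)%N%:Z).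
Qed.

Lemma residue_eq0W x m n : (m <= n)%N -> x n = 0 -> x m = 0.
Proof.
by move=> /subnK <-; elim: (n - m)%N => [|i IH] // xi; apply: IH;
   rewrite residueS xi mod0z.
Qed.

Lemma residue_at0 x : x 0%N = 0.
Proof. by rewrite residueS expn0 modz1. Qed.

End PadicRing.

Section PadicNorm.
Variable p : nat.
Implicit Types (x y z : padic_int p) (n : nat).

Lemma padic_neq0 x : x != 0 -> exists n, x n.+1 != 0.
Proof.
move=> x0; apply: contrapT => /forallNP x0n; case/eqP: x0.
apply: padic_eqP => -[|n]; rewrite residue0 ?residue_at0//.
by apply/eqP; have /negP := x0n n; rewrite negbK.
Qed.

(* the largest n such that p ^ n divides x; the value 0 at x = 0 is junk *)
Definition padic_val x : nat :=
  if pselect (exists n, x n.+1 != 0) is left ex then ex_minn ex else 0%N.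

Definition padic_norm (R : realType) x : R :=
  if x == 0 then 0 else p%:R ^- padic_val x.

Lemma padic_valP x n : x != 0 -> (n <= padic_val x)%N = (x n == 0).
Proof.
rewrite /padic_val => x0; case: pselect => [ex|]; last first.
  by move/(_ (padic_neq0 x0)).
case: ex_minnP => v xv vmin; apply/idP/eqP => [nv|xn].
  case: n nv => [_|n nv]; first exact: residue_at0.
  apply/eqP/negP => /negP xn; have := vmin n xn.
  by rewrite leqNgt nv.
rewrite leqNgt; apply/negP => vn; move/eqP: xv; apply.
exact: residue_eq0W xn.
Qed.

End PadicNorm.

Section PadicMetric.
Variables (R : realType) (p : nat).
Implicit Types (x y z : padic_int p) (n : nat).
Local Notation N := (@padic_norm p R).

Lemma padic_norm0 : N 0 = 0. Proof. by rewrite /padic_norm eqxx. Qed.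

Lemma padic_norm_ge0 x : 0 <= N x.
Proof. by rewrite /padic_norm; case: ifP => // _; rewrite invr_ge0 exprn_ge0. Qed.

Lemma exprVn_homo m n : (m <= n)%N -> p%:R ^- n <= p%:R ^- m :> R.
Proof.
case: p => [|q] mn; first by case: m n mn => [|m] [|n] //=;
  rewrite ?expr0 ?invr1 // !expr0n /= ?invr0 ?ler01.
rewrite lef_pV2 ?posrE ?exprn_gt0 ?ltr0n// ler_weXn2l// ler1n//.
Qed.

Lemma padic_norm_le1 x : N x <= 1.
Proof.
rewrite /padic_norm; case: ifP => // _.
by have := @exprVn_homo 0 (padic_val x) (leq0n _); rewrite expr0 invr1.
Qed.

Lemma padic_norm_eq0 x : (1 < p)%N -> (N x == 0) = (x == 0).
Proof.
move=> p1; rewrite /padic_norm; case: (x == 0); first by rewrite eqxx.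
by rewrite invr_eq0 expf_eq0 pnatr_eq0 (gtn_eqF (ltnW p1)) andbF.
Qed.

Lemma padic_norm_le x n : (1 < p)%N -> (N x <= p%:R ^- n) = (x n == 0).
Proof.
move=> p1; have p0 : (0 < p)%N by exact: ltnW.
rewrite /padic_norm; case: ifPn => [/eqP ->|x0].
  by rewrite residue0 eqxx invr_ge0 exprn_ge0.
rewrite -padic_valP// lef_pV2 ?posrE ?exprn_gt0 ?ltr0n//.
by rewrite ler_eXn2l ?ltr1n.
Qed.

Lemma padic_normN x : N (- x) = N x.
Proof.
have H n y : y n = 0 -> (- y) n = 0 by rewrite residueN => ->; rewrite oppr0 mod0z.
have V y : y != 0 -> y (padic_val y) = 0 by move=> y0; apply/eqP; rewrite -padic_valP.
rewrite /padic_norm oppr_eq0; case: ifPn => // x0.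
have Nx0 : - x != 0 by rewrite oppr_eq0.
congr (_ ^- _); apply/eqP; rewrite eqn_leq !padic_valP//.
apply/andP; split; apply/eqP; last exact: H (V _ x0).
by have := H _ _ (V _ Nx0); rewrite opprK.
Qed.

Lemma padic_norm_ultra x y : N (x + y) <= Num.max (N x) (N y).
Proof.
have [->|x0] := eqVneq x 0; first by rewrite add0r padic_norm0 le_max lexx orbT.
have [->|y0] := eqVneq y 0; first by rewrite addr0 padic_norm0 le_max lexx.
have [->|xy0] := eqVneq (x + y) 0.
  by rewrite padic_norm0 le_max padic_norm_ge0.
rewrite /padic_norm (negPf x0) (negPf y0) (negPf xy0).
have /orP[h|h] : (padic_val x <= padic_val (x + y)%R)%N
               || (padic_val y <= padic_val (x + y)%R)%N.
- rewrite -geq_min padic_valP// residueD.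
  have := geq_minl (padic_val x) (padic_val y).
  have := geq_minr (padic_val x) (padic_val y).
  by rewrite !padic_valP// => /eqP -> /eqP ->; rewrite addr0 mod0z.
- by rewrite le_max (exprVn_homo h).
- by rewrite le_max (exprVn_homo h) orbT.
Qed.

Lemma padic_norm_prime : prime p -> N p%:R = p%:R^-1.
Proof.
move=> pp; have p1 := prime_gt1 pp.
have natE n k : (n%:R : padic_int p) k = (n%:Z %% (p ^ k)%N%:Z)%Z.
  elim: n => [|n IH]; first by rewrite residue0 mod0z.
  by rewrite mulrS residueD IH modzDm -intS.
apply/eqP; rewrite eq_le -[p%:R^-1](expr1 (_ : R)) exprVn.
rewrite padic_norm_le// natE expn1 modzz eqxx /= leNgt; apply/negP.
have nz : (p%:R : padic_int p) != 0.
  apply/eqP => /(congr1 (fun x : padic_int p => x 2%N)).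
  rewrite natE residue0 modz_small ?ltz_nat //= ?ltn_Pmull ?(ltnW p1)//.
  by case; move: p1; case: (p).
rewrite /padic_norm (negPf nz) ltf_pV2 ?posrE ?exprn_gt0 ?ltr0n ?(ltnW p1)//.
rewrite ltr_eXn2l ?ltr1n// padic_valP// natE modz_small ?ltz_nat.
  by rewrite eqz_nat (gtn_eqF (ltnW p1)).
by rewrite -[X in (X < _)%N]expn1 ltn_exp2l.
Qed.

End PadicMetric.

Section PadicUniform.
Variable p : nat.
Local Open Scope relation_scope.

(* The uniform structure of Z_p, given by congruence modulo p^n; it does not
   mention the codomain R of the norm. That it is the one induced by
   d(x, y) = ||x - y|| is padic_entourageE below. *)
Definition padic_entourage : set_system (padic_int p * padic_int p) :=
  filter_from setT
    (fun n => [set xy : padic_int p * padic_int p | xy.1 n = xy.2 n]).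

Fact padic_entourage_filter : Filter padic_entourage.
Proof.
apply: filter_from_filter; first by exists 0%N.
move=> m n _ _; exists (maxn m n) => //= -[x y] /= /residueB_eq0 xy.
by split; apply/residueB_eq0; apply: residue_eq0W xy;
   rewrite ?leq_maxl ?leq_maxr.
Qed.

Fact padic_entourage_diagonal A : padic_entourage A -> diagonal `<=` A.
Proof. by move=> [n _ nA] [x y] /= xy; apply: nA => /=; rewrite -[y]xy. Qed.

Fact padic_entourage_inv A : padic_entourage A -> padic_entourage A^-1.
Proof. by move=> [n _ nA]; exists n => // -[x y] /= xy; apply: nA. Qed.

Fact padic_entourage_split A : padic_entourage A ->
  exists2 B, padic_entourage B & B \; B `<=` A.
Proof.
move=> [n _ nA].
exists [set xy : padic_int p * padic_int p | xy.1 n = xy.2 n]; first by exists n.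
by move=> [x y] [z /= xz zy]; apply: nA => /=; exact: etrans xz zy.
Qed.

HB.instance Definition _ := isUniform.Build (padic_int p)
  padic_entourage_filter padic_entourage_diagonal padic_entourage_inv
  padic_entourage_split.

End PadicUniform.

Section PadicMetricInstance.
Variables (R : realType) (p : nat).
Local Notation N := (@padic_norm p R).

Definition padic_dist (x y : padic_int p) : R := N (x - y).

Definition padic_ball (x : padic_int p) (e : R) : set (padic_int p) :=
  [set y | padic_dist x y < e].

Fact padic_ball_center x (e : R) : 0 < e -> padic_ball x e x.
Proof. by rewrite /padic_ball/= /padic_dist subrr padic_norm0. Qed.

Fact padic_ball_sym x y (e : R) : padic_ball x e y -> padic_ball y e x.
Proof. by rewrite /padic_ball/= /padic_dist -padic_normN opprB. Qed.

Fact padic_ball_triangle x y z (e1 e2 : R) :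
  padic_ball x e1 y -> padic_ball y e2 z -> padic_ball x (e1 + e2) z.
Proof.
rewrite /padic_ball/= /padic_dist => xy yz.
rewrite -(subrKA y); apply: le_lt_trans (ltrD xy yz).
apply: le_trans (padic_norm_ultra _ _ _) _.
by rewrite ge_max lerDl lerDr !padic_norm_ge0.
Qed.

Fact residue_le1 (x : padic_int p) n : (p <= 1)%N -> x n.+1 = x 1%N.
Proof.
elim: n => [|n IH]// p1; rewrite -{}IH// [RHS]residueS.
case: p p1 x => [|[|//]] _ x; first by rewrite exp0n// modz0.
by rewrite residueS !exp1n !modz1.
Qed.

Fact padic_norm_small (x : padic_int p) : (p <= 1)%N -> N x = (x != 0)%:R.
Proof.
move=> p1; rewrite /padic_norm; case: ifPn => //= x0.
suff -> : padic_val x = 0%N by rewrite expr0 invr1.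
apply/eqP; rewrite -leqn0 leqNgt padic_valP//.
by have [m] := padic_neq0 x0; rewrite residue_le1.
Qed.

Fact padic_norm_lt_residue n :
  exists2 e : R, 0 < e & forall x : padic_int p, N x < e -> x n = 0.
Proof.
have [p1|p1] := leqP p 1.
  exists 1 => // x; rewrite padic_norm_small//.
  by have [->|_] := eqVneq x 0; rewrite ?residue0// ltxx.
exists (p%:R ^- n); first by rewrite invr_gt0 exprn_gt0// ltr0n (ltnW p1).
by move=> x /ltW; rewrite padic_norm_le// => /eqP.
Qed.

Fact residue_padic_norm_lt (e : R) : 0 < e ->
  exists n, forall x : padic_int p, x n = 0 -> N x < e.
Proof.
move=> e0; have [p1|p1] := leqP p 1.
  exists 1%N => x x1; suff -> : x = 0 by rewrite padic_norm0.
  by apply: padic_eqP => -[|n]; rewrite residue0 ?residue_at0// residue_le1.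
have [n en] : exists n, e^-1 < n%:R.
  by exists (Num.bound e^-1); rewrite archi_boundP// invr_ge0 ltW.
exists n => x xn; have : N x <= p%:R ^- n by rewrite padic_norm_le// xn.
move=> /le_lt_trans; apply; rewrite -[e]invrK.
rewrite ltf_pV2 ?posrE ?invr_gt0 ?exprn_gt0 ?ltr0n ?(ltnW p1)//.
by apply: lt_trans en _; rewrite -natrX ltr_nat ltn_expl.
Qed.

Fact padic_entourageE :
  @entourage (padic_int p) = entourage_ padic_ball.
Proof.
apply/seteqP; split=> A.
- move=> [n _ nA]; have [e e0 en] := padic_norm_lt_residue n.
  by exists e => // -[x y] /= /en /residueB_eq0 xy; apply: nA.
- move=> [e /= e0 eA]; have [n ne] := residue_padic_norm_lt e0.
  by exists n => // -[x y] /= /residueB_eq0 /ne xy; apply: eA.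
Qed.

HB.instance Definition _ := Uniform_isPseudoMetric.Build R (padic_int p)
  padic_ball_center padic_ball_sym padic_ball_triangle padic_entourageE.

Fact padic_dist_ge0 x y : 0 <= padic_dist x y.
Proof. exact: padic_norm_ge0. Qed.

Fact padic_dist_positivity x y : padic_dist x y = 0 -> x = y.
Proof.
rewrite /padic_dist => /eqP xy; apply/eqP; rewrite -subr_eq0; move: xy.
have [p1|p1] := leqP p 1; last by rewrite padic_norm_eq0.
by rewrite padic_norm_small// pnatr_eq0 eqb0 negbK.
Qed.

Fact padic_ballEdist x (e : R) :
  ball x e = [set y | padic_dist x y < e].
Proof. by []. Qed.

HB.instance Definition _ := PseudoMetric_isMetric.Build R (padic_int p)
  padic_dist_ge0 padic_dist_positivity padic_ballEdist.

End PadicMetricInstance.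

Definition homeomorphism (X Y : topologicalType) (h : X -> Y) :=
  continuous h /\
  exists h' : Y -> X, [/\ continuous h', cancel h h' & cancel h' h].

Definition topologically_conjugate (X : topologicalType) (f g : X -> X) :=
  exists h : X -> X, homeomorphism h /\ f \o h = h \o g.

Section PadicMaps.
Variables (R : realType) (p : nat).
Implicit Types (f psi : padic_int p -> padic_int p) (r s L : R).

Definition locally_scaling r s f :=
  forall x y, padic_norm R (x - y) <= r ->
    padic_norm R (f x - f y) = s * padic_norm R (x - y).

Definition padic_lipschitz L psi :=
  forall x y, padic_norm R (psi x - psi y) <= L * padic_norm R (x - y).

Definition padic_supnorm psi : R :=
  sup (range (fun x => padic_norm R (psi x))).

(* sup is only meaningful on nonempty bounded sets *)
Lemma has_sup_padic_norm psi : has_sup (range (fun x => padic_norm R (psi x))).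
Proof.
split; first by exists (padic_norm R (psi 0)), 0.
by exists 1 => _ [x _ <-]; exact: padic_norm_le1.
Qed.

Definition lipschitz_structurally_stable f :=
  continuous f /\
  exists2 eps : R, 0 < eps &
    forall psi, padic_lipschitz eps psi -> padic_supnorm psi < eps ->
      topologically_conjugate f (f \+ psi).

End PadicMaps.

(* Main.v *)
Require Import Defs.
From mathcomp Require Import all_boot all_order all_algebra.
From mathcomp Require Import all_classical all_reals.
From mathcomp Require Import topology.
Import Order.TTheory GRing.Theory Num.Theory.
Local Open Scope classical_set_scope.
Local Open Scope ring_scope.

(* If [f] and [g] both expand by [p ^ m] on balls of radius [p ^- k] and agree
   modulo [p ^ k], every [g]-orbit is shadowed modulo [p ^ k] by the [f]-orbit
   of a unique point [h x]: it exists because [f] maps a ball of radius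
   [p ^- k] onto a ball of radius [p ^ (m - k)], and it is unique because
   orbits that stay congruent modulo [p ^ k] coincide.  Uniqueness makes [h]
   intertwine [f] and [g], and exchanging [f] and [g] yields its inverse. *)

Lemma residue_eqW {p : nat} {x y : padic_int p} {a b : nat} :
  (a <= b)%N -> x b = y b -> x a = y a.
Proof.
by move=> ab /residueB_eq0 xy; apply/residueB_eq0; apply: residue_eq0W xy.
Qed.

Lemma padic_lim {p : nat} {u : nat -> padic_int p} :
  (forall n, u n.+1 n = u n n) -> exists l : padic_int p, forall n, l n = u n n.
Proof.
move=> uS; have coh : `[< padic_coherent p (fun n => u n n) >].
  by apply/asboolP => n; rewrite -residueS uS.
by exists (PadicInt coh).
Qed.

Lemma continuous_residue {p : nat} (h : padic_int p -> padic_int p) :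
  (forall n, exists N, forall x y : padic_int p, x N = y N -> h x n = h y n) ->
  continuous h.
Proof.
move=> hcont x; apply: (proj2 (cvg_app_entourageP h (nbhs_filter x) (h x))) => A [n _ nA].
have [N hN] := hcont n.
have : nbhs x (xsection [set xy : padic_int p * padic_int p | xy.1 N = xy.2 N] x).
  by apply: nbhs_entourage; exists N.
apply: filterS => y; rewrite /xsection /= inE /= => /hN xy.
exact: nA.
Qed.

Lemma residue_digit {p : nat} (w : padic_int p) (n : nat) : (0 < p)%N ->
  w n.+1 \in [seq w n + (p ^ n * i)%N%:Z | i <- iota 0 p].
Proof.
move=> p0; have pn0 : (0 < p ^ n)%N by rewrite expn_gt0 p0.
have pS0 : (0 < p ^ n.+1)%N by rewrite expn_gt0 p0.
have w0 : 0 <= w n.+1 by rewrite -residue_mod modz_ge0// gt_eqF.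
have wp : w n.+1 < (p ^ n.+1)%N by rewrite -residue_mod ltz_pmod.
case: (w n.+1) w0 wp (residueS w n) => // a _ ap ->.
apply/mapP; exists (a %/ p ^ n)%N.
  by rewrite mem_iota add0n /= ltn_divLR// mulnC -expnSr.
by rewrite modz_nat -PoszD mulnC addnC -divn_eq.
Qed.

(** For [1 < p] and [m <= k] both norms are zero or powers [p ^- j], so their equality can be tested
    against every threshold [p ^- n], that is, by congruences. *)
Definition residue_scaling {p : nat} (k m : nat) (f : padic_int p -> padic_int p) :=
  forall (x y : padic_int p) (n : nat), x k = y k ->
    (x (n + m)%N == y (n + m)%N) = (f x n == f y n).

Lemma locally_scaling_residue {R : realType} {p k m : nat}
    {f : padic_int p -> padic_int p} : (1 < p)%N ->
  locally_scaling (p%:R ^- k : R) (p%:R ^+ m : R) f -> residue_scaling k m f.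
Proof.
move=> p1 fs x y n xy.
have eqE (a b : padic_int p) j :
    (a j == b j) = (padic_norm R (a - b) <= p%:R ^- j).
  rewrite padic_norm_le//.
  by apply/eqP/eqP => /residueB_eq0.
have p0 : 0 < p%:R :> R by rewrite ltr0n ltnW.
rewrite !eqE fs; last by rewrite -eqE xy.
by rewrite exprD invfM -ler_pdivlMl ?exprn_gt0// mulrC.
Qed.

Section ResidueScaling.
Context {p k m : nat} {f : padic_int p -> padic_int p}.
Hypotheses (p_gt1 : (1 < p)%N) (m_gt0 : (0 < m)%N) (m_le_k : (m <= k)%N).
Hypothesis f_scaling : residue_scaling k m f.
Implicit Types x y z : padic_int p.

Lemma scaling_image {x y n} : (k <= n + m)%N ->
  x (n + m)%N = y (n + m)%N -> f x n = f y n.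
Proof.
move=> kn xy; apply/eqP; rewrite -f_scaling ?xy//.
exact: residue_eqW xy.
Qed.

(** Each application of [f] costs [m] digits of precision. *)
Lemma scaling_iter {x y n i} : (k <= n)%N ->
  x (n + i * m)%N = y (n + i * m)%N -> iter i f x n = iter i f y n.
Proof.
elim: i x y => [|i IH] x y kn; first by rewrite mul0n addn0.
rewrite !iterSr mulSn addnCA addnC => xy; apply: IH => //.
by apply: scaling_image => //; rewrite -addnA (leq_trans kn)// leq_addr.
Qed.

(** Conversely, pulling a congruence back one step along orbits that agree modulo [p ^ k] gains [m]
    digits. *)
Lemma scaling_expansive {x y N} :
  (forall i, (i <= N)%N -> iter i f x k = iter i f y k) ->
  x (k + N * m)%N = y (k + N * m)%N.
Proof.
elim: N x y => [|N IH] x y xy; first by rewrite mul0n addn0; apply: (xy 0%N).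
rewrite mulSn addnCA addnC; apply/eqP; rewrite f_scaling; last exact: (xy 0%N).
by apply/eqP/IH => i iN; rewrite -!iterSr xy.
Qed.

Lemma scaling_expansive_eq {x y} :
  (forall i, iter i f x k = iter i f y k) -> x = y.
Proof.
move=> xy; apply: padic_eqP => n.
apply: (@residue_eqW _ _ _ _ (k + n * m)); last exact: scaling_expansive.
by rewrite (leq_trans (leq_pmulr n m_gt0))// leq_addl.
Qed.

(* The [p] lifts of [y] modulo [p ^ (n + m + 1)] have distinct images modulo
   [p ^ n.+1], so by pigeonhole these exhaust the [p] lifts of [f y]. *)
Lemma scaling_lift_digit {y z n} : (k <= n + m)%N -> f y n = z n ->
  exists2 y' : padic_int p, y' (n + m)%N = y (n + m)%N & f y' n.+1 = z n.+1.
Proof.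
move=> kn fyz; have p_gt0 := ltnW p_gt1.
pose Y i := y + padic_of_int p (p ^ (n + m) * i)%N%:Z.
have YE i : Y i (n + m)%N = y (n + m)%N.
  by rewrite /Y residueD /= modzDmr PoszM [_%:Z * _]mulrC addrC modzMDl residue_mod.
have fYE i : f (Y i) n = z n by rewrite -fyz; apply: scaling_image.
pose s := [seq f (Y i) n.+1 | i <- iota 0 p].
pose t := [seq z n + (p ^ n * i)%N%:Z | i <- iota 0 p].
have s_uniq : uniq s.
  rewrite map_inj_in_uniq ?iota_uniq// => i j.
  rewrite !mem_iota !add0n /= => ip jp /eqP.
  rewrite -f_scaling; last by apply: (@residue_eqW _ _ _ _ (n + m)) => //; rewrite !YE.
  rewrite addSn /Y !residueD /= !modzDmr eqz_mod_dvd opprD addrACA subrr add0r.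
  rewrite -eqz_mod_dvd !modz_small ?ltz_nat ?expnSr ?ltn_pmul2l ?expn_gt0 ?p_gt0//.
  by rewrite eqz_nat eqn_pmul2l ?expn_gt0 ?p_gt0// => /eqP.
have s_sub_t : {subset s <= t}.
  move=> _ /mapP[i _ ->]; rewrite /t -(fYE i); exact: residue_digit.
have [_ st] : (size s = size t) * (s =i t).
  by apply: uniq_min_size => //; rewrite !size_map.
have : z n.+1 \in s by rewrite st; apply: residue_digit.
by move=> /mapP[i _ zE]; exists (Y i).
Qed.

(** As in Hensel's lemma, [y] is a limit of approximate solutions, starting from [x] and improved
    one digit at a time. *)
Lemma scaling_inverse_branch {x z} : f x (k - m)%N = z (k - m)%N ->
  exists2 y : padic_int p, y k = x k & f y = z.
Proof.
move=> fxz.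
have approx n : exists y : padic_int p, y k = x k /\ f y (n + (k - m))%N = z (n + (k - m))%N.
  elim: n => [|n [y [yx fyz]]]; first by exists x.
  have kn : (k <= n + (k - m) + m)%N by rewrite -addnA subnK// leq_addl.
  have [y' y'y fy'z] := scaling_lift_digit kn fyz.
  by exists y'; split=> //; rewrite -yx; apply: residue_eqW y'y.
have /choice[u uP] := approx.
(* The [u n] are chosen independently, yet they are compatible: all agree with [x] modulo [p ^ k],
   so scaling turns congruent images into congruent points. *)
have uS n : u n.+1 n = u n n.
  apply: (@residue_eqW _ _ _ _ (n + (k - m) + m)).
    by rewrite -addnA leq_addr.
  apply/eqP; rewrite f_scaling; last by rewrite !(proj1 (uP _)).
  rewrite (proj2 (uP n)); apply/eqP.
  by apply: residue_eqW (proj2 (uP n.+1)); rewrite leq_add2r.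
have [l lu] := padic_lim uS.
exists l; first by rewrite lu (proj1 (uP k)).
(* [N] is [n + k + m] reordered: [l] and [u N] agree modulo [p ^ N], hence their images agree modulo
   [p ^ (n + k)]. *)
apply: padic_eqP => n; pose N := (n + m + k)%N.
have -> : f l n = f (u N) n.
  apply: (@residue_eqW _ _ _ _ (n + k)); first exact: leq_addr.
  by apply: scaling_image; rewrite addnAC ?lu// leq_addl.
by apply: residue_eqW (proj2 (uP N)); rewrite /N -!addnA leq_addr.
Qed.

Lemma scaling_continuous : continuous f.
Proof.
apply: continuous_residue => n; exists (n + k + m)%N => x y xy.
apply: (@residue_eqW _ _ _ _ (n + k)); first exact: leq_addr.
by apply: scaling_image => //; rewrite addnAC leq_addl.
Qed.

(** A finite piece of orbit is shadowed by working backwards: the inverse branch of [f] near [x] is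
    applied to a shadow of the orbit of [g x]. Expansiveness makes these finite shadows converge. *)
Lemma scaling_shadowing {g : padic_int p -> padic_int p} :
  (forall x, f x k = g x k) ->
  forall x, exists y, forall i, iter i f y k = iter i g x k.
Proof.
move=> fg x.
have finite N : forall x, exists y,
    forall i, (i <= N)%N -> iter i f y k = iter i g x k.
  elim: N => [|N IH] {}x; first by exists x => i; rewrite leqn0 => /eqP ->.
  have [y' y'g] := IH (g x).
  have [|y yx fy] := @scaling_inverse_branch x y'.
    apply: (@residue_eqW _ _ _ _ k); first exact: leq_subr.
    by rewrite fg -(y'g 0%N).
  exists y => -[//|i] iN.
  by rewrite !iterSr fy y'g.
have /choice[u uP] := finite^~ x.
have uS n : u n.+1 n = u n n.
  apply: (@residue_eqW _ _ _ _ (k + n * m)).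
    by rewrite (leq_trans (leq_pmulr n m_gt0))// leq_addl.
  by apply: scaling_expansive => i iN; rewrite !uP// leqW.
have [l lu] := padic_lim uS.
(* Knowing [l] modulo [p ^ (k + i * m)] determines its [i]-th iterate modulo [p ^ k], and [i <= N]
   lets [u N] shadow up to time [i]. *)
exists l => i; pose N := (k + i * m)%N.
rewrite -(uP N); last by rewrite (leq_trans (leq_pmulr i m_gt0))// leq_addl.
exact: scaling_iter.
Qed.

End ResidueScaling.

(** The first [n] steps of the [g]-orbit of [x] fix [h x] modulo [p ^ (k + n * m)], and they depend
    only on [x] modulo that same power. *)
Lemma shadowing_continuous {p k m : nat} {f g h : padic_int p -> padic_int p} :
  (0 < m)%N -> residue_scaling k m f -> residue_scaling k m g ->
  (forall x i, iter i f (h x) k = iter i g x k) -> continuous h.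
Proof.
move=> m0 fs gs hP; apply: continuous_residue => n.
exists (k + n * m)%N => x y xy; apply: (@residue_eqW _ _ _ _ (k + n * m)).
  by rewrite (leq_trans (leq_pmulr n m0))// leq_addl.
apply: (scaling_expansive fs) => i iN; rewrite !hP.
apply: (scaling_iter gs) => //; apply: residue_eqW xy.
by rewrite leq_add2l leq_mul2r iN orbT.
Qed.

Lemma residue_scaling_conjugate {p k m : nat} {f g : padic_int p -> padic_int p} :
  (1 < p)%N -> (0 < m)%N -> (m <= k)%N ->
  residue_scaling k m f -> residue_scaling k m g ->
  (forall x, f x k = g x k) -> topologically_conjugate f g.
Proof.
move=> p1 m0 mk fs gs fg.
have /choice[h hP] := scaling_shadowing p1 m0 mk fs fg.
have /choice[h' h'P] := scaling_shadowing p1 m0 mk gs (fun x => esym (fg x)).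
exists h; split; last first.
  (* Both [f (h x)] and [h (g x)] shadow the [g]-orbit of [g x]. *)
  apply: funext => x /=; apply: (scaling_expansive_eq m0 fs) => i.
  by rewrite hP -!iterSr hP.
split; first exact: shadowing_continuous m0 fs gs hP.
exists h'; split; first exact: shadowing_continuous m0 gs fs h'P.
- by move=> x; apply: (scaling_expansive_eq m0 gs) => i; rewrite h'P hP.
- by move=> x; apply: (scaling_expansive_eq m0 fs) => i; rewrite hP h'P.
Qed.

(** Since [psi] does not expand while [f] expands by [p ^ m] with [0 < m], the variation of [f]
    dominates in the ultrametric inequality. *)
Lemma residue_scaling_perturb {p k m : nat} {f psi : padic_int p -> padic_int p} :
  (0 < m)%N -> (m <= k)%N -> residue_scaling k m f ->
  (forall (x y : padic_int p) n, x n = y n -> psi x n = psi y n) ->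
  residue_scaling k m (f \+ psi).
Proof.
move=> m0 mk fs psiL x y n xy.
have addE j : psi x j = psi y j ->
    ((f \+ psi) x j == (f \+ psi) y j) = (f x j == f y j).
  move=> psixy; rewrite !residueD psixy eqz_mod_dvd opprD addrACA subrr addr0 -eqz_mod_dvd.
  by rewrite !residue_mod.
apply/idP/idP => [xyn|].
  rewrite addE -?fs//; apply: psiL; apply: residue_eqW (eqP xyn).
  exact: leq_addr.
(* Cancelling [psi] modulo [p ^ n.+1] needs [x] and [y] congruent there; the induction hypothesis
   gives this modulo [p ^ (n + m)], enough as [0 < m]. *)
elim: n => [_|n IH gxy]; first by apply/eqP; apply: residue_eqW xy.
have /eqP xyn : x (n + m)%N == y (n + m)%N.
  by apply: IH; apply/eqP; apply: residue_eqW (eqP gxy).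
rewrite fs// -addE//; apply: psiL; apply: residue_eqW xyn.
by rewrite -addn1 leq_add2l.
Qed.

Theorem theorem6 (R : realType) (p k m : nat)
    (f : padic_int p -> padic_int p)
    (p_prime : prime p) (m_ge1 : (1 <= m)%N) (m_le_k : (m <= k)%N)
    (f_scaling : locally_scaling (p%:R ^- k : R) (p%:R ^+ m : R) f) :
  lipschitz_structurally_stable R f.
Proof.
have p1 := prime_gt1 p_prime; have p0 : 0 < p%:R :> R by rewrite ltr0n ltnW.
have fs := locally_scaling_residue p1 f_scaling.
split; first exact: scaling_continuous fs.
(* The sup bound makes [psi] vanish modulo [p ^ k]; as a Lipschitz constant, [p ^- k] is at most 1,
   so [psi] preserves congruences. *)
exists (p%:R ^- k) => [|psi psiL psi_small]; first by rewrite invr_gt0 exprn_gt0.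
have psi0 x : psi x k = 0.
  apply/eqP; rewrite -(padic_norm_le R)//.
  apply: le_trans (ltW psi_small).
  by apply: ub_le_sup; [exact: (has_sup_padic_norm R psi).2 | exists x].
have psiC (x y : padic_int p) n : x n = y n -> psi x n = psi y n.
  move=> /residueB_eq0/eqP; rewrite -(padic_norm_le R)// => xy.
  apply/residueB_eq0/eqP; rewrite -(padic_norm_le R)//.
  apply: le_trans (psiL x y) _; apply: le_trans xy.
  rewrite ler_piMl ?padic_norm_ge0//.
  by rewrite invf_le1 ?exprn_gt0// exprn_ege1// ler1n ltnW.
apply: (residue_scaling_conjugate p1 m_ge1 m_le_k fs).
  exact: residue_scaling_perturb.
by move=> x; rewrite residueD psi0 addr0 residue_mod.
Qed.
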